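(* Let $p$ be a prime and let $q\in\mathbb{C}_p$ with $q\neq 1$ and $|q-1|_p<p^{-1/(p-1)}$. For every $n\in\mathbb{Z}_{+}=\{0,1,2,\dots\}$, $$\beta_{n, q} = \frac{1}{(1-q)^{n}} \sum^{n}_{l=0} \binom{n}{l}(-1)^{l} \sum^{l}_{k=0} (q-1)^{k}\begin{bmatrix} l \\ k\end{bmatrix}_{q} \sum_{m=0}^{k} s_{1, q} (k, m)\, \beta_{m, q},$$ where $\beta_{m,q}$ are the Carlitz $q$-Bernoulli numbers and $s_{1,q}(k,m)$ are the $q$-Stirling numbers of the first kind.
   Context: $\mathbb{C}_p$ is the completion of an algebraic closure of $\mathbb{Q}_p$, with $|p|_p=1/p$; under the assumption on $q$, $q^x=\exp(x\log q)$ for $x\in\mathbb{Z}_p$. Set $[x]_q=\frac{1-q^x}{1-q}$. For $f:\mathbb{Z}_p\to\mathbb{C}_p$ continuously differentiable, the $p$-adic $q$-integral is $\int_{\mathbb{Z}_p} f(x)\,d\mu_q(x)=\lim_{N\to\infty}\frac{1}{[p^N]_q}\sum_{x=0}^{p^N-1}f(x)q^x$. The Carlitz $q$-Bernoulli numbers are $\beta_{m,q}=\int_{\mathbb{Z}_p}[x]_q^m\,d\mu_q(x)$ for $m\ge 0$. The $q$-binomial coefficient is $\begin{bmatrix} n\\k\end{bmatrix}_q=\frac{[n]_q!}{[k]_q![n-k]_q!}$ with $[n]_q!=\prod_{i=1}^n[i]_q$. Let $[x]_{k,q}=[x]_q[x-1]_q\cdots[x-k+1]_q$ (with $[x]_{0,q}=1$).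 The $q$-Stirling numbers of the first kind $s_{1,q}(k,l)$, $0\le l\le k$, are the numbers (independent of $x$) such that $[x]_{k,q}=q^{-\binom{k}{2}}\sum_{l=0}^{k}s_{1,q}(k,l)[x]_q^l$ for all $x$. *)

(* Defs.v *)
From HB Require Import structures.
From mathcomp Require Import all_boot all_order all_algebra.
From mathcomp Require Import all_classical all_reals all_analysis.

Set Implicit Arguments.
Unset Strict Implicit.
Unset Printing Implicit Defensive.

Import Order.TTheory GRing.Theory Num.Theory.

Local Open Scope classical_set_scope.
Local Open Scope ring_scope.

(* The absolute value is not a [normedZmodType] norm: the latter requires
   [`|x *+ n| = `|x| *+ n], which fails for non-archimedean absolute values. *)
Record nonArchField (R : realType) := NonArchField {
  naField : fieldType ;
  naAbs : naField -> R ;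
  naAbs_ge0 : forall x, 0 <= naAbs x ;
  naAbs_eq0 : forall x, (naAbs x == 0) = (x == 0) ;
  naAbsM : forall x y, naAbs (x * y) = naAbs x * naAbs y ;
  naAbsD : forall x y, naAbs (x + y) <= Num.max (naAbs x) (naAbs y)
}.

(* A separate constant, so that the topology below is attached to it and not
   to arbitrary fields. *)
Definition naSort (R : realType) (K : nonArchField R) : Type := naField K.
Coercion naSort : nonArchField >-> Sortclass.

HB.instance Definition _ (R : realType) (K : nonArchField R) :=
  GRing.Field.copy (naSort K) (naField K).

Definition pabs (R : realType) (K : nonArchField R) (x : K) : R := naAbs x.

Section NonArchTopology.
Variables (R : realType) (K : nonArchField R).
Implicit Types x y z : K.

Lemma pabs_ge0 x : 0 <= pabs x. Proof. exact: naAbs_ge0. Qed.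

Lemma pabs_eq0 x : (pabs x == 0) = (x == 0). Proof. exact: naAbs_eq0. Qed.

Lemma pabsM x y : pabs (x * y) = pabs x * pabs y. Proof. exact: naAbsM. Qed.

Lemma pabsD x y : pabs (x + y) <= Num.max (pabs x) (pabs y).
Proof. exact: naAbsD. Qed.

Lemma pabs0 : pabs (0 : K) = 0. Proof. by apply/eqP; rewrite pabs_eq0. Qed.

Lemma pabs1 : pabs (1 : K) = 1.
Proof.
have nz : pabs (1 : K) != 0 by rewrite pabs_eq0 oner_eq0.
by apply: (mulfI nz); rewrite -pabsM !mulr1.
Qed.

Lemma pabsN x : pabs (- x) = pabs x.
Proof.
have /eqP : pabs (-1 : K) ^+ 2 = 1 by rewrite expr2 -pabsM mulrNN mulr1 pabs1.
rewrite sqrf_eq1 => /orP[/eqP h|/eqP h].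
  by rewrite -mulN1r pabsM h mul1r.
by have := pabs_ge0 (-1); rewrite h oppr_ge0 ler10.
Qed.

Definition pdist x y : R := pabs (x - y).

Lemma pdistxx x : pdist x x = 0. Proof. by rewrite /pdist subrr pabs0. Qed.

Lemma pdist_positivity x y : pdist x y = 0 -> x = y.
Proof. by move/eqP; rewrite pabs_eq0 subr_eq0 => /eqP. Qed.

Lemma pdist_sym x y : pdist x y = pdist y x.
Proof. by rewrite /pdist -pabsN opprB. Qed.

Lemma pdist_triangle y x z : pdist x z <= pdist x y + pdist y z.
Proof.
rewrite /pdist -(subrKA y) (le_trans (pabsD _ _))// ge_max.
by rewrite lerDl lerDr !pabs_ge0.
Qed.

HB.instance Definition _ := isPointed.Build K 0.
HB.instance Definition _ := isMetric.Build R K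
  pdistxx pdist_positivity pdist_sym pdist_triangle.

Definition integer_pred : pred K := [pred x : K | pabs x <= 1].

Lemma integer_subring : subring_closed integer_pred.
Proof.
split=> [|x y|x y]; rewrite !inE => *.
- by rewrite pabs1.
- by rewrite (le_trans (pabsD _ _))// pabsN ge_max; apply/andP.
- by rewrite pabsM mulr_ile1// pabs_ge0.
Qed.

HB.instance Definition _ :=
  GRing.isSubringClosed.Build K integer_pred integer_subring.

(* The subring {x | pabs x <= 1}; for K = Q_p it is Z_p. *)
Record integer_ring := IntegerRing {
  integer_val :> K ;
  integer_valP : integer_pred integer_val
}.

HB.instance Definition _ := [isSub for integer_val].
HB.instance Definition _ := [Choice of integer_ring by <:].
HB.instance Definition _ :=
  [SubChoice_isSubComNzRing of integer_ring by <:].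

End NonArchTopology.

(* Q_p, an algebraic closure of it with the extended absolute value, and the
   completion C_p of that closure; each step is determined up to isometric
   isomorphism.  The absolute value induced on Q is the p-adic one: the value
   at p and the ultrametric inequality force this. *)
Record padicTower (R : realType) (p : nat) := PadicTower {
  Qp : nonArchField R ;
  Qpbar : nonArchField R ;
  Cp : nonArchField R ;
  Qp_Qpbar : {rmorphism Qp -> Qpbar} ;
  Qpbar_Cp : {rmorphism Qpbar -> Cp} ;
  pabs_p : pabs (p%:R : Qp) = p%:R^-1 ;
  dense_rat_Qp : dense (range (ratr : rat -> Qp)) ;
  complete_Qp : forall F : set_system Qp, ProperFilter F -> cauchy F -> cvg F ;
  algebraic_Qpbar : forall x : Qpbar, algebraicOver Qp_Qpbar x ;
  closed_Qpbar : GRing.closed_field_axiom Qpbar ;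
  pabs_Qp_Qpbar : forall x : Qp, pabs (Qp_Qpbar x) = pabs x ;
  dense_Qpbar_Cp : dense (range Qpbar_Cp) ;
  complete_Cp : forall F : set_system Cp, ProperFilter F -> cauchy F -> cvg F ;
  pabs_Qpbar_Cp : forall x : Qpbar, pabs (Qpbar_Cp x) = pabs x
}.

Definition padicInt (R : realType) (p : nat) (T : padicTower R p) :=
  integer_ring (Qp T).

Definition padicInt_Cp (R : realType) (p : nat) (T : padicTower R p)
  (x : padicInt T) :
  Cp T := Qpbar_Cp T (Qp_Qpbar T (val x)).

Section ExpLog.
Variables (R : realType) (K : nonArchField R).

Definition padic_exp (z : K) : K :=
  limn (series (fun n : nat => z ^+ n / n`!%:R)).

(* log u = \sum_(n >= 1) (-1)^(n-1) (u - 1)^n / n *)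
Definition padic_log (u : K) : K :=
  limn (series (fun n : nat => (-1) ^+ n * (u - 1) ^+ n.+1 / n.+1%:R)).

End ExpLog.

Section QCalculus.
Variables (R : realType) (p : nat) (T : padicTower R p) (q : Cp T).

Definition qpow (x : padicInt T) : Cp T :=
  padic_exp (padicInt_Cp x * padic_log q).

Definition qnum (x : padicInt T) : Cp T := (1 - qpow x) / (1 - q).

Definition qfact (n : nat) : Cp T := \prod_(1 <= i < n.+1) qnum i%:R.

Definition qbinom (n k : nat) : Cp T := qfact n / (qfact k * qfact (n - k)).

Definition qfalling (x : padicInt T) (k : nat) : Cp T :=
  \prod_(0 <= i < k) qnum (x - i%:R).

Definition qintegral (f : padicInt T -> Cp T) : Cp T :=
  limn (fun N : nat => (qnum (p ^ N)%:R)^-1 *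
                       \sum_(0 <= x < p ^ N) f x%:R * qpow x%:R).

Definition carlitz_bernoulli (m : nat) : Cp T :=
  qintegral (fun x => qnum x ^+ m).

Definition is_qStirling1 (s : nat -> nat -> Cp T) : Prop :=
  forall (k : nat) (x : padicInt T),
    qfalling x k = q ^- 'C(k, 2) * \sum_(0 <= l < k.+1) s k l * qnum x ^+ l.

End QCalculus.

(* Main.v *)
(* Expanding [[x]_q ^ n] by the binomial theorem in powers of [q ^ x] and each
   [(q ^ x) ^ l] by Cauchy's q-binomial identity
     X ^ l = \sum_k [l choose k]_q (X - 1) (X - q) ... (X - q ^ (k - 1)),
   whose products at [X = q ^ x] are [(q - 1) ^ k q ^ (k choose 2) [x]_(k,q)],
   turns the statement, before any limit, into an identity between the
   Riemann sums of the powers of [[x]_q].  These sums converge because those of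
   [(q ^ x) ^ l] are quotients of geometric sums and [q ^ (p ^ N)] tends to 1.

   All this needs [exp (n log q) = q ^ n], hence [exp (log q) = q], which comes
   from the limit [(u ^ M - 1) / M -> log u] along [M = p ^ N] and the equality
   [|w ^ M - 1| = |M| |w - 1|] rather than from formal power series. *)
Require Import Defs.
From mathcomp Require Import all_boot all_order all_algebra.
From mathcomp Require Import all_classical all_reals all_analysis.
From mathcomp Require Import ring zify.
Import Order.TTheory GRing.Theory Num.Theory.
Import numFieldNormedType.Exports.
Local Open Scope classical_set_scope.
Local Open Scope ring_scope.

(** * Limits in a non-archimedean field *)

Section NonArchLimits.
Variables (R : realType) (K : nonArchField R).
Implicit Types (x y l m : K) (u v : nat -> K).

Lemma pabsX x n : pabs (x ^+ n) = pabs x ^+ n.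
Proof. by elim: n => [|n IH]; rewrite ?expr0 ?pabs1// !exprS pabsM IH. Qed.

Lemma pabsV x : pabs x^-1 = (pabs x)^-1.
Proof.
have [->|x0] := eqVneq x 0; first by rewrite invr0 pabs0 invr0.
have ax0 : pabs x != 0 by rewrite pabs_eq0.
by apply: (mulfI ax0); rewrite -pabsM !mulfV// pabs1.
Qed.

Lemma pabs_sign n x : pabs ((-1) ^+ n * x) = pabs x.
Proof. by rewrite pabsM pabsX pabsN pabs1 expr1n mul1r. Qed.

Lemma pabs_nat_le1 n : pabs (n%:R : K) <= 1.
Proof.
elim: n => [|n IH]; first by rewrite pabs0.
by rewrite -natr1 (le_trans (pabsD _ _))// ge_max IH pabs1 lexx.
Qed.

Lemma pabsD_le {x y} (b : R) : pabs x <= b -> pabs y <= b -> pabs (x + y) <= b.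
Proof. by move=> xb yb; rewrite (le_trans (pabsD _ _))// ge_max xb. Qed.

Lemma pabsB_le {x y} (b : R) : pabs x <= b -> pabs y <= b -> pabs (x - y) <= b.
Proof. by move=> xb yb; apply: pabsD_le; rewrite ?pabsN. Qed.

Lemma pabs_sum_le (I : Type) (r : seq I) (P : pred I) (F : I -> K) (b : R) :
  0 <= b -> (forall i, P i -> pabs (F i) <= b) ->
  pabs (\sum_(i <- r | P i) F i) <= b.
Proof.
move=> b0 Fb; elim/big_rec: _ => [|i x Pi xb]; first by rewrite pabs0.
exact: pabsD_le (Fb i Pi) xb.
Qed.

(* Only the largest term of an ultrametric sum counts. *)
Lemma pabsD_lt x y : pabs y < pabs x -> pabs (x + y) = pabs x.
Proof.
move=> yx; apply/le_anti/andP; split; first by apply: pabsD_le => //; exact: ltW.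
have := pabsD (x + y) (- y); rewrite addrK pabsN le_max => /orP[//|].
by rewrite leNgt yx.
Qed.

(** Moves convergence in [K] to the reals, where squeezing and limit arithmetic apply; the rules for
    sums and products below rest on it. *)
Lemma nacvgP u l :
  u @ \oo --> l <-> (fun n => pabs (u n - l)) @ \oo --> (0 : R).
Proof.
split.
- move=> /cvg_ballP ul; apply/cvgrPdist_lt => e e0.
  have := ul e e0; apply: filterS => n /=.
  by rewrite /ball/= /pdist sub0r normrN ger0_norm ?pabs_ge0// -pabsN opprB.
- move=> /cvgrPdist_lt ul; apply/cvg_ballP => e e0.
  have := ul e e0; apply: filterS => n /=.
  by rewrite /ball/= /pdist sub0r normrN ger0_norm ?pabs_ge0// -[X in _ -> X < _]pabsN opprB.
Qed.

Lemma nacvg_le {u l} (b : nat -> R) :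
  (\forall n \near \oo, pabs (u n - l) <= b n) -> b @ \oo --> (0 : R) ->
  u @ \oo --> l.
Proof.
move=> ub b0; apply/nacvgP; apply: squeeze_cvgr b0; last exact: cvg_cst.
by apply: filterS ub => n ->; rewrite pabs_ge0.
Qed.

Lemma nacvg_unique u l m : u @ \oo --> l -> u @ \oo --> m -> l = m.
Proof.
by move=> ul um; apply: (cvg_unique _ ul um); exact: metric_hausdorff.
Qed.

Lemma nacvg_lim u l : u @ \oo --> l -> limn u = l.
Proof. by move=> ul; apply: cvg_lim ul; exact: metric_hausdorff. Qed.

Lemma nacvgD {u v l m} : u @ \oo --> l -> v @ \oo --> m ->
  (fun n => u n + v n) @ \oo --> l + m.
Proof.
move=> /nacvgP ul /nacvgP vm.
apply: (nacvg_le (fun n => pabs (u n - l) + pabs (v n - m))).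
  apply: nearW => n; rewrite opprD addrACA (le_trans (pabsD _ _))// ge_max.
  by rewrite lerDl lerDr !pabs_ge0.
by rewrite -[0]addr0; apply: cvgD ul vm.
Qed.

Lemma nacvgM {u v l m} : u @ \oo --> l -> v @ \oo --> m ->
  (fun n => u n * v n) @ \oo --> l * m.
Proof.
move=> /nacvgP ul /nacvgP vm.
apply: (nacvg_le (fun n => pabs (u n - l) * pabs (v n - m) +
   (pabs l * pabs (v n - m) + pabs (u n - l) * pabs m))).
  apply: nearW => n; rewrite -!pabsM.
  have -> : u n * v n - l * m = (u n - l) * (v n - m) +
     (l * (v n - m) + (u n - l) * m) by ring.
  apply: pabsD_le; first by rewrite lerDl addr_ge0 ?pabs_ge0.
  by apply: pabsD_le; rewrite addrCA ?lerDl ?addr_ge0 ?pabs_ge0//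
    addrCA addrA lerDr addr_ge0 ?pabs_ge0.
rewrite [X in _ --> X](_ : 0 = 0 * 0 + (pabs l * 0 + 0 * pabs m)); last by ring.
apply: cvgD; first exact: cvgM.
by apply: cvgD; apply: cvgM => //; exact: cvg_cst.
Qed.

Lemma nacvg_cst l : (fun _ : nat => l) @ \oo --> l.
Proof. exact: cvg_cst. Qed.

Lemma nacvgN {u l} : u @ \oo --> l -> (fun n => - u n) @ \oo --> - l.
Proof.
move=> /nacvgP ul; apply/nacvgP.
by under eq_fun do rewrite -opprD pabsN.
Qed.

Lemma nacvg_shift {u l} : u @ \oo --> l -> (fun n => u n.+1) @ \oo --> l.
Proof. by rewrite (cvg_shiftS u). Qed.

Lemma nacvg_sum (I : Type) (r : seq I) (F : I -> nat -> K) (L : I -> K) :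
  (forall i, F i @ \oo --> L i) ->
  (fun n => \sum_(i <- r) F i n) @ \oo --> \sum_(i <- r) L i.
Proof.
move=> FL; elim: r => [|i r IH].
  by under eq_fun do rewrite big_nil; rewrite big_nil; exact: nacvg_cst.
by under eq_fun do rewrite big_cons; rewrite big_cons; exact: nacvgD.
Qed.

Lemma nacvgX {u l} k : u @ \oo --> l -> (fun n => u n ^+ k) @ \oo --> l ^+ k.
Proof.
move=> ul; elim: k => [|k IH].
  by under eq_fun do rewrite expr0; exact: nacvg_cst.
by under eq_fun do rewrite exprS; rewrite exprS; exact: nacvgM.
Qed.

Lemma nacvg_pabs_le u l (b : R) :
  u @ \oo --> l -> (\forall n \near \oo, pabs (u n) <= b) -> pabs l <= b.
Proof.
move=> /nacvgP ul ub; apply/ler_addgt0Pl => e e0.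
have [n [un ule]] : exists n, pabs (u n) <= b /\ pabs (u n - l) < e.
  by apply: (@filter_ex _ \oo); apply: filterI ub _; exact: cvgr_lt ul _ e0.
rewrite -(subKr (u n) l); apply: pabsB_le.
  by rewrite (le_trans un)// lerDr ltW.
by rewrite (le_trans (ltW ule))// lerDl (le_trans (pabs_ge0 (u n))).
Qed.

(** An ultrametric Tannery theorem: the largest term bounds a sum whatever its length, so a majorant
    tending to 0 controls the tail and pointwise limits control the head. *)
Lemma nacvg_sum_dominated (a : nat -> nat -> K) (c : nat -> R)
    (d : nat -> nat) :
  (forall N k, pabs (a N k) <= c k) -> c @ \oo --> (0 : R) ->
  (forall k, (fun N => a N k) @ \oo --> (0 : K)) ->
  (fun N => \sum_(0 <= k < d N) a N k) @ \oo --> (0 : K).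
Proof.
move=> ac c0 a0; apply/nacvgP/cvgrPdist_le => e e0.
have [K0 _ cK0] := cvgr_lt 0 c0 e e0.
have small_head : \forall N \near \oo, forall k : 'I_K0, pabs (a N k) < e.
  apply: filter_forall => k; have /nacvgP := a0 k.
  by under eq_fun do rewrite subr0; move/cvgr_lt; apply.
apply: filterS small_head => N aN.
rewrite sub0r normrN subr0 ger0_norm ?pabs_ge0//.
apply: pabs_sum_le; first exact: ltW.
move=> k _; have [kK0|K0k] := ltnP k K0; first exact: ltW (aN (Ordinal kK0)).
exact: le_trans (ac N k) (ltW (cK0 k K0k)).
Qed.

Hypothesis complete : forall F : set_system K, ProperFilter F -> cauchy F -> cvg F.

(** A block of terms is no larger than its largest term, so the partial sums are Cauchy as soon as
    the terms tend to 0. *)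
Lemma nacvg_series (a : nat -> K) (c : nat -> R) :
  (forall k, pabs (a k) <= c k) -> c @ \oo --> (0 : R) ->
  series a @ \oo --> limn (series a).
Proof.
move=> ac c0; apply: complete; apply: cauchy_exP => e e0.
(* [pabs_sum_le] gives a weak inequality while balls are open, hence the half. *)
have e20 : 0 < e / 2 by rewrite divr_gt0.
have [N _ cN] := cvgr_lt 0 c0 _ e20.
exists (series a N); exists N => // n /= Nn.
rewrite /ball/= pdist_sym /pdist sub_series_geq//.
rewrite (@le_lt_trans _ _ (e / 2))//; last by rewrite ltr_pdivrMr// ltr_pMr// ltr1n.
rewrite big_nat; apply: pabs_sum_le; first exact: ltW.
by move=> k /andP[Nk _]; rewrite (le_trans (ac k))// ltW// cN.
Qed.

End NonArchLimits.

(** * The p-adic exponential and logarithm *)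

(** Legendre's formula with [m = n.+1]. The bound [n] rather than [m] later leaves one factor
    [pabs z] free in the estimates of terms. *)
Lemma logn_fact_le {p : nat} (n : nat) :
  prime p -> (p.-1 * logn p n.+1`! <= n)%N.
Proof.
move=> p_prime; rewrite logn_fact//; set m := n.+1.
(* Telescoping: [p] times the quotient by [p ^ j.+1] is at most the quotient by [p ^ j]. *)
have sum_le j : (p.-1 * \sum_(1 <= k < j.+1) m %/ p ^ k + m %/ p ^ j <= m)%N.
  elim: j => [|j IH]; first by rewrite big_geq// muln0 add0n expn0 divn1.
  rewrite big_nat_recr//= mulnDr (leq_trans _ IH)// -addnA leq_add2l.
  by rewrite -mulSnr prednK ?prime_gt0// expnSr divnMA mulnC leq_trunc_div.
suff sum_lt j : (p.-1 * \sum_(1 <= k < j.+1) m %/ p ^ k < m)%N.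
  exact: sum_lt m.
elim: j => [|j IH]; first by rewrite big_geq// muln0.
(* A zero quotient adds nothing; a positive one makes the inequality of [sum_le] strict. *)
have [mpj|] := posnP (m %/ p ^ j.+1); first by rewrite big_nat_recr//= mpj addn0.
by have := sum_le j.+1; lia.
Qed.

Lemma logn_succ_le {p : nat} (n : nat) :
  prime p -> (p.-1 * logn p n.+1 <= n)%N.
Proof.
move=> p_prime; apply: leq_trans (logn_fact_le n p_prime).
by rewrite leq_mul2l factS lognM ?fact_gt0// leq_addr orbT.
Qed.

(** Since [C(m, k+1) = m / (k+1) * C(m-1, k)], the factor [m] comes out; what remains is the series
    of [log (1 + t)], truncated, with [(-1) ^ k] replaced by [C(m-1, k)]. *)
Lemma binomial_series_coef {F : fieldType} (charF0 : forall n, n.+1%:R != 0 :> F)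
    (t : F) (m : nat) :
  (t + 1) ^+ m - 1 =
  m%:R * \sum_(0 <= k < m) 'C(m.-1, k)%:R * (t ^+ k.+1 / k.+1%:R).
Proof.
rewrite [t + 1]addrC exprDn big_ord_recl/= bin0 mulr1n subn0 expr1n mulr1 addrC addKr.
rewrite big_mkord mulr_sumr; apply: eq_bigr => i _.
rewrite expr1n mul1r /bump/= add1n mulrA -natrM mul_bin_diag natrM mulrCA mulrAC.
by rewrite mulfV// mul1r mulr_natr.
Qed.

(* The inverse of the radius of convergence of the p-adic exponential. *)
Definition inv_exp_radius (R : realType) (p : nat) : R :=
  p%:R `^ (p.-1%:R)^-1.

Section PadicExpLog.
Variables (R : realType) (p : nat) (K : nonArchField R).
Hypothesis p_prime : prime p.
Hypothesis pabs_pE : pabs (p%:R : K) = p%:R^-1.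
Hypothesis complete :
  forall F : set_system K, ProperFilter F -> cauchy F -> cvg F.

Local Notation tau := (inv_exp_radius R p).
Implicit Types (t u w z : K) (k n : nat).

(** * Absolute values of integers and bounds on series terms *)

Let p_gt0 : 0 < p%:R :> R. Proof. by rewrite ltr0n prime_gt0. Qed.

Let pV_lt1 : p%:R^-1 < 1 :> R.
Proof. by rewrite invf_lt1// ltr1n prime_gt1. Qed.

(** The part [m] of [n] prime to [p] has absolute value 1: in Bezout's relation [a * m = b * p + 1]
    the right side has absolute value 1, while those of [a] and [m] are at most 1. *)
Lemma pabs_natE n : (0 < n)%N -> pabs (n%:R : K) = (p%:R ^+ logn p n)^-1.
Proof.
move=> n0; have [m mp nE] := pfactor_coprime p_prime n0.
rewrite [in LHS]nE natrM natrX pabsM pabsX pabs_pE exprVn -[RHS]mul1r; congr (_ * _).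
apply/le_anti; rewrite pabs_nat_le1/=.
have := mp; rewrite coprime_sym => /coprimeP.
have m0 : (0 < m)%N by move: n0; rewrite nE muln_gt0 => /andP[].
move=> /(_ m0)[[a b] /= abE].
have {}abE : a%:R * m%:R = b%:R * p%:R + 1 :> K.
  by rewrite -!natrM natr1; congr _%:R; lia.
have : pabs (a%:R * m%:R : K) = 1.
  rewrite abE addrC pabsD_lt pabs1// pabsM pabs_pE.
  by rewrite (le_lt_trans _ pV_lt1)// ger_pMl ?invr_gt0// pabs_nat_le1.
rewrite pabsM => <-.
by rewrite ler_piMl ?pabs_ge0 ?pabs_nat_le1.
Qed.

Lemma natS_neq0 n : n.+1%:R != 0 :> K.
Proof. by rewrite -pabs_eq0 pabs_natE// invr_eq0 expf_neq0// gt_eqF. Qed.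

Let tau_ge1 : 1 <= tau.
Proof.
by rewrite /inv_exp_radius -[leLHS](powRr0 p%:R) ler_powR ?ler1n ?prime_gt0.
Qed.

Let tau_expr : tau ^+ p.-1 = p%:R.
Proof.
rewrite /inv_exp_radius -powR_mulrn ?powR_ge0// -powRrM mulVf ?powRr1 ?ler0n//.
by rewrite pnatr_eq0; have := prime_gt1 p_prime; lia.
Qed.

Let expr_logn_le m n : (0 < m)%N -> (p.-1 * logn p m <= n)%N ->
  (pabs (m%:R : K))^-1 <= tau ^+ n.
Proof.
move=> m0 mn; rewrite pabs_natE// invrK -tau_expr -exprM.
by apply: ler_weXn2l.
Qed.

(** The open disc of radius [1 / tau], written so that the ratio of the geometric majorants
    appears. *)
Definition in_exp_disc t := pabs t * tau < 1.

Lemma pabs_exp_termS z n :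
  pabs (z ^+ n.+1 / n.+1`!%:R) <= pabs z * (pabs z * tau) ^+ n.
Proof.
rewrite pabsM pabsV pabsX exprMn exprS -mulrA ler_wpM2l ?pabs_ge0//.
rewrite ler_wpM2l ?exprn_ge0 ?pabs_ge0//.
by rewrite expr_logn_le ?fact_gt0// logn_fact_le.
Qed.

Lemma pabs_exp_term z n : pabs (z ^+ n / n`!%:R) <= (pabs z * tau) ^+ n.
Proof.
case: n => [|n]; first by rewrite !expr0 fact0 divr1 pabs1.
apply: le_trans (pabs_exp_termS _ _) _; rewrite exprS ler_wpM2r//.
  by rewrite exprn_ge0// mulr_ge0 ?pabs_ge0// (le_trans _ tau_ge1).
by rewrite ler_peMr ?pabs_ge0 ?tau_ge1.
Qed.

Lemma pabs_log_term t n :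
  pabs (t ^+ n.+1 / n.+1%:R) <= pabs t * (pabs t * tau) ^+ n.
Proof.
rewrite pabsM pabsV pabsX exprMn exprS -mulrA ler_wpM2l ?pabs_ge0//.
rewrite ler_wpM2l ?exprn_ge0 ?pabs_ge0//.
by rewrite expr_logn_le ?logn_succ_le.
Qed.

Lemma pabs_tau_ge0 z : 0 <= pabs z * tau.
Proof. by rewrite mulr_ge0 ?pabs_ge0// (le_trans _ tau_ge1). Qed.

Lemma pabs_tau_expr_le1 z n : in_exp_disc z -> (pabs z * tau) ^+ n <= 1.
Proof. by move=> /ltW zd; rewrite exprn_ile1// pabs_tau_ge0. Qed.

Lemma pabs_ltV z : in_exp_disc z -> `|pabs z * tau| < 1.
Proof.
by move=> zd; rewrite ger0_norm// pabs_tau_ge0.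
Qed.

Lemma in_exp_disc_le z w : pabs z <= pabs w -> in_exp_disc w -> in_exp_disc z.
Proof.
move=> zw; apply: le_lt_trans; rewrite ler_wpM2r// (le_trans _ tau_ge1)//.
Qed.

Lemma in_exp_disc_lt1 z : in_exp_disc z -> pabs z < 1.
Proof.
by rewrite /in_exp_disc; apply: le_lt_trans; rewrite ler_peMr ?pabs_ge0 ?tau_ge1.
Qed.

Lemma cvg_geometric_pabs z (c : R) : in_exp_disc z ->
  (fun n => c * (pabs z * tau) ^+ n) @ \oo --> (0 : R).
Proof. by move=> zd; apply: cvg_geometric; exact: pabs_ltV. Qed.

(* For [k > 0] the terms of the expansion are smaller than the first one,
   [m * t]. *)
Lemma pabs_expr_sub1 w m :
  in_exp_disc (w - 1) -> pabs (w ^+ m - 1) = pabs (m%:R : K) * pabs (w - 1).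
Proof.
move=> wd; have [w1|w_neq1] := eqVneq (w - 1) 0.
  by move/eqP: w1; rewrite subr_eq0 => /eqP ->; rewrite expr1n subrr pabs0 mulr0.
case: m => [|m]; first by rewrite expr0 subrr pabs0 mul0r.
rewrite -{1}(subrK 1 w) binomial_series_coef; last exact: natS_neq0.
rewrite pabsM; congr (_ * _).
rewrite big_nat_recl// bin0 mul1r expr1 divr1 (pabsD_lt _ _ (w - 1))//.
apply: (@le_lt_trans _ _ (pabs (w - 1) * (pabs (w - 1) * tau))).
  apply: pabs_sum_le => [|k _].
    by rewrite mulr_ge0 ?pabs_ge0 ?pabs_tau_ge0.
  rewrite pabsM -[leRHS]mul1r ler_pM ?pabs_ge0 ?pabs_nat_le1//.
  apply: le_trans (pabs_log_term _ _) _.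
  rewrite ler_wpM2l ?pabs_ge0// exprS ler_piMr//.
    exact: pabs_tau_ge0.
  exact: pabs_tau_expr_le1.
by rewrite -[ltRHS]mulr1 ltr_pM2l// lt_def pabs_eq0 w_neq1 pabs_ge0.
Qed.

(** * Limits along powers of [p] *)

Lemma cvg_prime_pow0 : (fun N => (p ^ N)%:R : K) @ \oo --> (0 : K).
Proof.
apply: (nacvg_le _ _ (fun N => p%:R^-1 ^+ N)).
  by apply: nearW => N; rewrite subr0 natrX pabsX pabs_pE.
by apply: cvg_expr; rewrite ger0_norm ?invr_ge0 ?ler0n.
Qed.

Lemma prime_pow_neq0 N : (p ^ N)%:R != 0 :> K.
Proof.
have : (0 < p ^ N)%N by rewrite expn_gt0 prime_gt0.
by case: (p ^ N)%N => // n _; exact: natS_neq0.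
Qed.

Lemma cvg_expr_prime_pow w :
  in_exp_disc (w - 1) -> (fun N => w ^+ (p ^ N)) @ \oo --> (1 : K).
Proof.
move=> wd; apply/nacvgP; under eq_fun do rewrite pabs_expr_sub1//.
rewrite -[0](mul0r (pabs (w - 1))).
apply: cvgM; last exact: cvg_cst.
by have /nacvgP := cvg_prime_pow0; under eq_fun do rewrite subr0.
Qed.

Lemma cvg_bin_prime_pow k :
  (fun N => 'C((p ^ N).-1, k)%:R : K) @ \oo --> ((-1) ^+ k : K).
Proof.
elim: k => [|k IH].
  by under eq_fun do rewrite bin0; exact: nacvg_cst.
have -> : (fun N => 'C((p ^ N).-1, k.+1)%:R : K) =
    (fun N => ((p ^ N)%:R + - k.+1%:R) * 'C((p ^ N).-1, k)%:R * k.+1%:R^-1).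
  apply/funext => N; apply: (mulIf (natS_neq0 k)); rewrite mulfVK ?natS_neq0//.
  rewrite -natrM mulnC mul_bin_left natrM.
  have pN_gt0 : (0 < p ^ N)%N by rewrite expn_gt0 prime_gt0.
  (* For [p ^ N <= k] natural subtraction truncates, but the binomial coefficient is then 0. *)
  have [kN|Nk] := ltnP k (p ^ N); last by rewrite bin_small ?mulr0//; lia.
  by rewrite -natrB//; congr (_%:R * _); lia.
rewrite exprS [X in _ --> X](_ : _ = (0 + - k.+1%:R) * (-1) ^+ k * k.+1%:R^-1 :> K).
  apply: nacvgM; last exact: nacvg_cst.
  by apply: nacvgM IH; apply: nacvgD (nacvg_cst _ _ _); exact: cvg_prime_pow0.
by rewrite add0r [RHS]mulrAC; congr (_ * _); rewrite mulNr mulfV ?natS_neq0.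
Qed.

Lemma cvg_expn_prime : (fun N => p ^ N)%N @ \oo --> \oo.
Proof.
move=> A [n _ nA]; exists n => // N /= nN; apply: nA => /=.
by rewrite (leq_trans nN)// ltnW// ltn_expl// prime_gt1.
Qed.

(** * The logarithm *)

Lemma cvg_padic_log u : in_exp_disc (u - 1) ->
  series (fun n : nat => (-1) ^+ n * (u - 1) ^+ n.+1 / n.+1%:R) @ \oo -->
  padic_log u.
Proof.
move=> ud; apply: (nacvg_series _ _ complete _ _ _ (cvg_geometric_pabs _ (pabs (u - 1)) ud)).
by move=> k; rewrite -mulrA pabs_sign; exact: pabs_log_term.
Qed.

Lemma pabs_padic_log u : in_exp_disc (u - 1) ->
  pabs (padic_log u) <= pabs (u - 1).
Proof.
move=> ud; apply: nacvg_pabs_le (cvg_padic_log _ ud) _.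
apply: nearW => n; apply: pabs_sum_le => [|k _]; first exact: pabs_ge0.
rewrite -mulrA pabs_sign (le_trans (pabs_log_term _ _))// ler_piMr ?pabs_ge0//.
exact: pabs_tau_expr_le1.
Qed.

(** By the binomial expansion the quotient is a partial sum of the log series plus the errors
    [a N k], which tend to 0 for each [k] and have a geometric majorant. *)
Lemma padic_log_lim u : in_exp_disc (u - 1) ->
  (fun N => (u ^+ (p ^ N) - 1) / (p ^ N)%:R) @ \oo --> padic_log u.
Proof.
move=> ud; set t := u - 1.
pose a N k : K := ('C((p ^ N).-1, k)%:R - (-1) ^+ k) * (t ^+ k.+1 / k.+1%:R).
have -> : (fun N => (u ^+ (p ^ N) - 1) / (p ^ N)%:R) = (fun N =>
    series (fun n => (-1) ^+ n * t ^+ n.+1 / n.+1%:R) (p ^ N)%N +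
    \sum_(0 <= k < p ^ N) a N k).
  apply/funext => N; rewrite -{1}(subrK 1 u) binomial_series_coef.
    rewrite mulrC mulKf ?prime_pow_neq0// seriesEnat/= -big_split/=.
    by apply: eq_bigr => k _; rewrite /a -mulrA -mulrDl [X in _ = X * _]addrC subrK.
  exact: natS_neq0.
rewrite -[padic_log u]addr0; apply: nacvgD.
  by apply: cvg_comp cvg_expn_prime _; exact: cvg_padic_log ud.
apply: (nacvg_sum_dominated _ _ _ (fun k => pabs t * (pabs t * tau) ^+ k)).
- move=> N k; rewrite /a pabsM -[leRHS]mul1r ler_pM ?pabs_ge0 ?pabs_log_term//.
  by apply: pabsB_le; rewrite ?pabs_nat_le1// -[_ ^+ k]mulr1 pabs_sign pabs1.
- exact: cvg_geometric_pabs ud.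
- move=> k; rewrite /a -[0](mul0r (t ^+ k.+1 / k.+1%:R)).
  apply: nacvgM (nacvg_cst _ _ _); rewrite -(subrr ((-1) ^+ k)).
  by apply: nacvgD (nacvg_cst _ _ _); exact: cvg_bin_prime_pow.
Qed.

(** * The exponential *)

Lemma cvg_padic_exp z : in_exp_disc z ->
  series (fun n : nat => z ^+ n / n`!%:R) @ \oo --> padic_exp z.
Proof.
move=> zd; apply: nacvg_series (pabs_exp_term z) _ => //.
by apply: cvg_expr; exact: pabs_ltV.
Qed.

Lemma padic_exp0 : padic_exp (0 : K) = 1.
Proof.
apply: nacvg_lim; rewrite -(cvg_shiftS _).
under eq_fun => n.
  rewrite seriesEnat/= big_nat_recl// expr0 fact0 divr1 big1 ?addr0.
    over.
  by move=> k _; rewrite exprS !mul0r.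
exact: nacvg_cst.
Qed.

Lemma pabs_padic_exp_sub1 z : in_exp_disc z ->
  pabs (padic_exp z - 1) <= pabs z.
Proof.
move=> zd; have := nacvgD _ _ (nacvg_shift _ _ (cvg_padic_exp _ zd)) (nacvg_cst _ _ (- 1)).
move/nacvg_pabs_le; apply; apply: nearW => n.
rewrite seriesEnat/= big_nat_recl// expr0 fact0 divr1 addrAC subrr add0r.
apply: pabs_sum_le => [|k _]; first exact: pabs_ge0.
rewrite (le_trans (pabs_exp_termS _ _))// ler_piMr ?pabs_ge0//.
exact: pabs_tau_expr_le1.
Qed.

(** Both sides run over the pairs with [i + j < n]: by diagonals on the left, by rows on the
    right. *)
Lemma triangular_sum_mul (a b : nat -> K) n :
  \sum_(0 <= m < n) \sum_(i < m.+1) a i * b (m - i)%N =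
  \sum_(0 <= i < n) a i * \sum_(0 <= j < n - i) b j.
Proof.
elim: n => [|n IH]; first by rewrite !big_nil.
rewrite big_nat_recr//= IH [RHS]big_nat_recr//=.
rewrite big_ord_recr/= subSnn big_nat1 subnn addrA; congr (_ + _).
rewrite -(big_mkord xpredT (fun i => a i * b (n - i)%N)) -big_split/=.
apply: eq_big_nat => i /andP[_ ilt].
by rewrite subSn 1?ltnW// big_nat_recr//= mulrDr.
Qed.

(** The product of partial sums exceeds the partial sum of the product by the terms with [i, j < n]
    and [i + j >= n], each at most [rho ^ (i + j) <= rho ^ n]. *)
Lemma padic_expD z w : in_exp_disc z -> in_exp_disc w ->
  padic_exp (z + w) = padic_exp z * padic_exp w.
Proof.
move=> zd wd.
have zwd : in_exp_disc (z + w).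
  by have := pabsD z w; rewrite le_max => /orP[]/in_exp_disc_le; apply.
pose e (x : K) (n : nat) : K := x ^+ n / n`!%:R.
have expDE m : e (z + w) m = \sum_(i < m.+1) e z i * e w (m - i)%N.
  rewrite /e addrC exprDn mulr_suml; apply: eq_bigr => i _.
  have im : (i <= m)%N by rewrite -ltnS.
  have fact0 k : k`!%:R != 0 :> K.
    by have := fact_gt0 k; case: (k`!) => // k' _; exact: natS_neq0.
  have binE : 'C(m, i)%:R * (i`!%:R * (m - i)`!%:R) = m`!%:R :> K.
    by rewrite -!natrM bin_fact.
  rewrite -mulr_natr mulrACA [RHS]mulrC -invfM.
  apply: (mulIf (fact0 m)); rewrite mulfVK//.
  rewrite -{}binE; field; apply/andP; split; exact: fact0.
apply/eqP; rewrite -subr_eq0; apply/eqP.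
pose rho := Num.max (pabs z * tau) (pabs w * tau).
have rho_ge0 : 0 <= rho by rewrite le_max pabs_tau_ge0.
have rho_lt1 : rho < 1 by rewrite gt_max; apply/andP.
have cvg_diff : (fun n => series (e (z + w)) n - series (e z) n * series (e w) n)
    @ \oo --> padic_exp (z + w) - padic_exp z * padic_exp w.
  by apply: nacvgD; [|apply: nacvgN; apply: nacvgM]; exact: cvg_padic_exp.
apply: nacvg_unique cvg_diff _.
apply: (nacvg_le _ _ (fun n => rho ^+ n)); last first.
  by apply: cvg_expr; rewrite ger0_norm.
apply: nearW => n; rewrite subr0 !seriesEnat/=.
under eq_bigr do rewrite expDE.
rewrite triangular_sum_mul mulr_suml -sumrB [X in pabs X]big_nat.
apply: pabs_sum_le => [|i /andP[_ ilt]]; first exact: exprn_ge0.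
(* Only the indices [n - i <= j < n] survive the subtraction. *)
rewrite -mulrBr (@big_cat_nat _ _ _ (n - i) 0 n)//= ?leq_subr//.
rewrite opprD addNKr -pabsN -mulrN opprK mulr_sumr big_nat.
apply: pabs_sum_le => [|j /andP[nij jn]]; first exact: exprn_ge0.
rewrite pabsM (@le_trans _ _ (rho ^+ i * rho ^+ j))//.
  by apply: ler_pM; rewrite ?pabs_ge0//; apply: le_trans (pabs_exp_term _ _) _;
    apply: lerXn2r; rewrite ?nnegrE ?pabs_tau_ge0// le_max lexx ?orbT.
by rewrite -exprD ler_wiXn2l// ?ltW//; lia.
Qed.

Lemma in_exp_disc_mull x z : pabs x <= 1 -> in_exp_disc z -> in_exp_disc (x * z).
Proof. by move=> x1; apply: in_exp_disc_le; rewrite pabsM ler_piMl ?pabs_ge0. Qed.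

Lemma padic_exp_natmul z n : in_exp_disc z ->
  padic_exp (n%:R * z) = padic_exp z ^+ n.
Proof.
move=> zd; elim: n => [|n IH]; first by rewrite mul0r padic_exp0.
rewrite -natr1 mulrDl mul1r padic_expD ?IH ?exprSr//.
exact: in_exp_disc_mull (pabs_nat_le1 _ _ _) zd.
Qed.

(** With [M = p ^ N] the quotient is [(exp (M z) - 1) / M]. The terms of [exp (M z)] of degree at
    least 2 sum to at most [|M| ^ 2], so the error after division is at most [|M|]. *)
Lemma padic_exp_lim z : in_exp_disc z ->
  (fun N => (padic_exp z ^+ (p ^ N) - 1) / (p ^ N)%:R) @ \oo --> z.
Proof.
move=> zd; apply: (nacvg_le _ _ (fun N => pabs ((p ^ N)%:R : K))); last first.
  by have /nacvgP := cvg_prime_pow0; under eq_fun do rewrite subr0.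
apply: nearW => N; set M : K := (p ^ N)%:R.
have M0 : M != 0 by exact: prime_pow_neq0.
rewrite -padic_exp_natmul// -/M -{2}(mulKf M0 z) [_^-1 * _]mulrC -mulrBl.
rewrite pabsM pabsV ler_pdivrMr ?lt_def ?pabs_eq0 ?M0 ?pabs_ge0//.
have Mzd : in_exp_disc (M * z) by apply: in_exp_disc_mull zd; exact: pabs_nat_le1.
rewrite -addrA.
have := nacvgD _ _ (nacvg_shift _ _ (nacvg_shift _ _ (cvg_padic_exp _ Mzd)))
  (nacvg_cst _ _ (- 1 - M * z)).
move/nacvg_pabs_le; apply; apply: nearW => n.
rewrite seriesEnat/= big_nat_recl// big_nat_recl// expr0 fact0 expr1 !divr1.
rewrite addrACA subrr add0r addrAC subrr add0r.
apply: pabs_sum_le => [|k _]; first by rewrite mulr_ge0 ?pabs_ge0.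
rewrite exprMn -mulrA pabsM pabsX -[leRHS]mulr1.
rewrite ler_pM ?exprn_ge0 ?pabs_ge0//.
  by rewrite 2!exprS mulrA ler_piMr ?mulr_ge0 ?pabs_ge0// exprn_ile1 ?pabs_ge0 ?pabs_nat_le1.
by rewrite (le_trans (pabs_exp_term _ _))// pabs_tau_expr_le1.
Qed.

(* With [M = p ^ N], both [(u ^+ M - 1) / M] and [(exp (log u) ^+ M - 1) / M]
   tend to [log u], so that [(w ^+ M - 1) / M] tends to [0] for
   [w = u / exp (log u)], whereas its absolute value is [pabs (w - 1)]. *)
Lemma padic_expK u : in_exp_disc (u - 1) -> padic_exp (padic_log u) = u.
Proof.
move=> ud; set L := padic_log u.
have Ld : in_exp_disc L by exact: in_exp_disc_le (pabs_padic_log _ ud) ud.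
have NLd : in_exp_disc (- L) by rewrite /in_exp_disc pabsN.
have EE : padic_exp (- L) * padic_exp L = 1.
  by rewrite -padic_expD// addNr padic_exp0.
set E := padic_exp (- L) in EE; pose w := u * E.
suff w1 : w = 1 by rewrite -[LHS]mul1r -w1 /w -mulrA EE mulr1.
have Ed : in_exp_disc (E - 1).
  exact: in_exp_disc_le (pabs_padic_exp_sub1 _ NLd) NLd.
have wd : in_exp_disc (w - 1).
  have -> : w - 1 = u * (E - 1) + (u - 1) by rewrite /w; ring.
  have uE1 : in_exp_disc (u * (E - 1)).
    apply: in_exp_disc_mull Ed; rewrite -(subrK 1 u).
    by apply: pabsD_le; rewrite ?pabs1// ltW// in_exp_disc_lt1.
  by have := pabsD (u * (E - 1)) (u - 1); rewrite le_max => /orP[]/in_exp_disc_le; apply.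
have w_lim : (fun N => (w ^+ (p ^ N) - 1) / (p ^ N)%:R) @ \oo --> (0 : K).
  (* [w ^ M - 1 = u ^ M (E ^ M - 1) + (u ^ M - 1)]; as [u ^ M] tends to 1, the limits [- L] and [L]
     cancel. *)
  rewrite (_ : (fun N => _) = (fun N =>
    u ^+ (p ^ N) * ((E ^+ (p ^ N) - 1) / (p ^ N)%:R) +
    (u ^+ (p ^ N) - 1) / (p ^ N)%:R)); last first.
    apply/funext => N; rewrite /w exprMn mulrA -mulrDl; congr (_ / _); ring.
  rewrite -(addNr L) -[- L]mul1r; apply: nacvgD; last exact: padic_log_lim.
  by apply: nacvgM; [exact: cvg_expr_prime_pow|exact: padic_exp_lim].
apply/eqP; rewrite -subr_eq0 -pabs_eq0; apply/eqP.
have /nacvgP := w_lim.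
under eq_fun => N.
  rewrite subr0 pabsM pabsV pabs_expr_sub1// mulrAC mulfV ?mul1r; first over.
  by rewrite pabs_eq0 prime_pow_neq0.
by move/(cvg_lim (@Rhausdorff R)); rewrite lim_cst//; exact: Rhausdorff.
Qed.

End PadicExpLog.

(** * q-calculus and Riemann sums *)

Section QIntegral.
Variables (R : realType) (p : nat) (T : padicTower R p) (q : Cp T).
Hypothesis p_prime : prime p.
Hypothesis q_neq1 : q != 1.
Hypothesis q_near1 : pabs (q - 1) < p%:R `^ (- (p.-1%:R)^-1).
Implicit Types (x y : padicInt T) (n k l m : nat).

(** * Powers [q ^ x] and q-numbers *)

Lemma padicInt_Cp_nat n : padicInt_Cp (n%:R : padicInt T) = n%:R.
Proof. by rewrite /padicInt_Cp !rmorph_nat. Qed.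

Lemma padicInt_CpB x y :
  padicInt_Cp (x - y) = padicInt_Cp x - padicInt_Cp y.
Proof. by rewrite /padicInt_Cp !rmorphB. Qed.

Lemma pabs_padicInt_Cp x : pabs (padicInt_Cp x) <= 1.
Proof.
by rewrite /padicInt_Cp pabs_Qpbar_Cp pabs_Qp_Qpbar; exact: integer_valP.
Qed.

Lemma pabs_p_Cp : pabs (p%:R : Cp T) = p%:R^-1.
Proof.
by rewrite -padicInt_Cp_nat /padicInt_Cp pabs_Qpbar_Cp pabs_Qp_Qpbar rmorph_nat pabs_p.
Qed.

Let completeC := @complete_Cp R p T.

Let q_disc : in_exp_disc R p (Cp T) (q - 1).
Proof.
rewrite /in_exp_disc /inv_exp_radius -ltr_pdivlMr ?powR_gt0 ?ltr0n ?prime_gt0//.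
by rewrite div1r -powRN.
Qed.

Let logq_disc : in_exp_disc R p (Cp T) (padic_log q).
Proof.
apply: (in_exp_disc_le _ _ _ p_prime _ _ _ q_disc).
exact: (pabs_padic_log _ _ _ p_prime pabs_p_Cp completeC _ q_disc).
Qed.

(** The one place where [exp (log q) = q] enters. *)
Lemma qpow_nat n : qpow q (n%:R : padicInt T) = q ^+ n.
Proof.
rewrite /qpow padicInt_Cp_nat (padic_exp_natmul _ _ _ p_prime pabs_p_Cp)//.
by rewrite (padic_expK _ _ _ p_prime pabs_p_Cp).
Qed.

Lemma qpowB_nat x n : qpow q (x - n%:R) * q ^+ n = qpow q x.
Proof.
rewrite -qpow_nat /qpow padicInt_CpB.
have disc y : in_exp_disc R p (Cp T) (padicInt_Cp y * padic_log q).
  exact: (in_exp_disc_mull _ _ _ p_prime _ _ (pabs_padicInt_Cp y)).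
rewrite -(padic_expD _ _ _ p_prime pabs_p_Cp)// -?padicInt_CpB//.
by congr (padic_exp _); rewrite padicInt_CpB; ring.
Qed.

(** [q] is not a root of unity, because [|q ^ n - 1| = |n| |q - 1|]; hence q-factorials are
    invertible. *)
Lemma expr_q_neq1 n : (0 < n)%N -> q ^+ n != 1.
Proof.
case: n => // n _.
rewrite -subr_eq0 -pabs_eq0 (pabs_expr_sub1 _ _ _ p_prime pabs_p_Cp)//.
by rewrite mulf_neq0// pabs_eq0 ?subr_eq0// (natS_neq0 _ _ _ p_prime pabs_p_Cp).
Qed.

Lemma qnum_nat n : qnum q (n%:R : padicInt T) = (1 - q ^+ n) / (1 - q).
Proof. by rewrite /qnum qpow_nat. Qed.

Let q1_neq0 : 1 - q != 0. Proof. by rewrite subr_eq0 eq_sym. Qed.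

Lemma qnum_nat_neq0 n : qnum q (n.+1%:R : padicInt T) != 0.
Proof.
by rewrite qnum_nat mulf_neq0 ?invr_eq0// subr_eq0 eq_sym expr_q_neq1.
Qed.

(** * q-binomial coefficients and Cauchy's identity *)

Lemma qfactS n : qfact q n.+1 = qfact q n * qnum q (n.+1%:R : padicInt T).
Proof. by rewrite /qfact big_nat_recr. Qed.

Lemma qfact_neq0 n : qfact q n != 0.
Proof.
elim: n => [|n IH]; first by rewrite /qfact big_geq ?oner_neq0.
by rewrite qfactS mulf_neq0 ?qnum_nat_neq0.
Qed.

Lemma qfact0 : qfact q 0 = 1 :> Cp T.
Proof. by rewrite /qfact big_geq. Qed.

Lemma qbinom0 n : qbinom q n 0 = 1.
Proof. by rewrite /qbinom qfact0 subn0 mul1r mulfV ?qfact_neq0. Qed.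

Lemma qbinomnn n : qbinom q n n = 1.
Proof. by rewrite /qbinom subnn qfact0 mulr1 mulfV ?qfact_neq0. Qed.

(** The q-Pascal rule, from [[n+1] = [k+1] + q ^ (k+1) [n-k]]. It stops at [k < n]: truncated
    subtraction makes [qbinom q n n.+1] equal to [1 / [n+1]] instead of 0. *)
Lemma qbinomS n k : (k < n)%N ->
  qbinom q n.+1 k.+1 = qbinom q n k + q ^+ k.+1 * qbinom q n k.+1.
Proof.
move=> kn; rewrite /qbinom subSS.
have -> : (n - k = (n - k.+1).+1)%N by lia.
rewrite !qfactS.
have numE : qnum q (n.+1%:R : padicInt T) = qnum q (k.+1%:R : padicInt T) +
    q ^+ k.+1 * qnum q ((n - k.+1).+1%:R : padicInt T).
  rewrite !qnum_nat mulrA -mulrDl; congr (_ / _).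
  by rewrite mulrBr mulr1 -exprD addrA subrK; congr (1 - _ ^+ _); lia.
rewrite numE; field.
by rewrite !qfact_neq0 !qnum_nat_neq0.
Qed.

(** Multiplication by [X] shifts the products by [PS], and the q-Pascal rule collects the
    coefficients. *)
Lemma cauchy_qbinomial (X : Cp T) l :
  X ^+ l = \sum_(0 <= k < l.+1) qbinom q l k * \prod_(0 <= i < k) (X - q ^+ i).
Proof.
set P := fun k => \prod_(0 <= i < k) (X - q ^+ i).
elim: l => [|l IH]; first by rewrite big_nat1 qbinom0 mul1r big_geq.
have PS k : X * P k = P k.+1 + q ^+ k * P k.
  by rewrite /P big_nat_recr//=; ring.
rewrite exprS IH mulr_sumr.
under eq_bigr do rewrite mulrCA PS mulrDr.
(* The extreme terms are split off, since [qbinomS] covers only the inner coefficients. *)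
rewrite big_split/= big_nat_recr//= [X in _ + X]big_nat_recl//.
rewrite [RHS]big_nat_recl// [X in _ = _ + X]big_nat_recr//=.
rewrite !qbinom0 !qbinomnn expr0 !mul1r.
have -> : \sum_(0 <= k < l) qbinom q l.+1 k.+1 * P k.+1 =
    \sum_(0 <= k < l) qbinom q l k * P k.+1 +
    \sum_(0 <= k < l) qbinom q l k.+1 * (q ^+ k.+1 * P k.+1).
  rewrite -big_split/=; apply: eq_big_nat => k /andP[_ kl].
  by rewrite qbinomS//; ring.
ring.
Qed.

Section Stirling.
Variable s : nat -> nat -> Cp T.
Hypothesis s_Stirling : is_qStirling1 q s.

(** Each factor is [(q - 1) q ^ i [x - i]]; the [q ^ i] multiply to [q ^ C(k, 2)], which cancels the
    prefactor in the definition of the Stirling numbers. *)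
Lemma prod_qpow_sub x k : \prod_(0 <= i < k) (qpow q x - q ^+ i) =
  (q - 1) ^+ k * \sum_(0 <= m < k.+1) s k m * qnum q x ^+ m.
Proof.
have q_neq0 : q != 0.
  (* [q = 0] would give [|q - 1| = 1], outside the disc. *)
  apply: contraTneq q_disc => ->.
  apply/negP => /(in_exp_disc_lt1 _ _ _ p_prime).
  by rewrite sub0r pabsN pabs1 ltxx.
have := s_Stirling k x; rewrite /qfalling.
move=> /(congr1 ( *%R (q ^+ 'C(k, 2)))); rewrite mulVKf ?expf_neq0// => <-.
rewrite -bin2_sum -prodrXr -[k in (q - 1) ^+ k]subn0 -prodr_const_nat.
rewrite -!big_split/=; apply: eq_bigr => i _.
rewrite -{1}(qpowB_nat x i) /qnum.
by field.
Qed.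

Lemma qpow_expr x l : qpow q x ^+ l = \sum_(0 <= k < l.+1)
  (q - 1) ^+ k * qbinom q l k * \sum_(0 <= m < k.+1) s k m * qnum q x ^+ m.
Proof.
rewrite cauchy_qbinomial; apply: eq_bigr => k _.
by rewrite prod_qpow_sub mulrCA mulrA.
Qed.

End Stirling.

(** * Riemann sums of powers *)

Lemma qnum_expr x n : qnum q x ^+ n =
  ((1 - q) ^+ n)^-1 *
  \sum_(0 <= l < n.+1) 'C(n, l)%:R * (-1) ^+ l * qpow q x ^+ l.
Proof.
rewrite /qnum exprMn exprVn mulrC [(1 - qpow q x) ^+ n]exprBn big_mkord; congr (_ * _).
apply: eq_bigr => l _; rewrite expr1n mulr1 -mulr_natl; ring.
Qed.

(** The sequence under the limit in [qintegral], named so that linearity can be used before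
    convergence is known. *)
Definition qriemann (f : padicInt T -> Cp T) (N : nat) : Cp T :=
  (qnum q ((p ^ N)%:R : padicInt T))^-1 *
  \sum_(0 <= x < p ^ N) f x%:R * qpow q x%:R.

Lemma eq_qriemann f g : f =1 g -> qriemann f = qriemann g.
Proof.
move=> fg; apply/funext => N; congr (_ * _).
by apply: eq_bigr => x _; rewrite fg.
Qed.

Lemma qriemannZ (c : Cp T) f N :
  qriemann (fun x => c * f x) N = c * qriemann f N.
Proof.
rewrite /qriemann mulrCA; congr (_ * _).
by rewrite mulr_sumr; apply: eq_bigr => x _; rewrite mulrA.
Qed.

Lemma qriemann_sum a b (f : nat -> padicInt T -> Cp T) N :
  qriemann (fun x => \sum_(a <= i < b) f i x) N =
  \sum_(a <= i < b) qriemann (f i) N.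
Proof.
rewrite /qriemann -mulr_sumr exchange_big/=; congr (_ * _).
by apply: eq_bigr => x _; rewrite mulr_suml.
Qed.

Lemma qriemann_qpow_expr l N : qriemann (fun x => qpow q x ^+ l) N =
  (1 - q) / (1 - q ^+ l.+1) * \sum_(i < l.+1) (q ^+ (p ^ N)) ^+ i.
Proof.
rewrite /qriemann qnum_nat.
under eq_bigr do rewrite qpow_nat -exprSr exprAC.
rewrite big_mkord.
have ql := expr_q_neq1 l.+1 isT.
have qM : q ^+ (p ^ N) != 1 by rewrite expr_q_neq1// expn_gt0 prime_gt0.
(* [q ^ (p ^ N * l.+1) - 1] is factored in two ways; the factor [q ^ (p ^ N) - 1], which tends to 0,
   then cancels against the q-number in front. *)
have := subrX1 (q ^+ l.+1) (p ^ N); rewrite exprAC subrX1.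
set S := \sum_(i < l.+1) _; set S' := \sum_(i < p ^ N) _ => SE.
have {SE}-> : S' = (q ^+ (p ^ N) - 1) * S / (q ^+ l.+1 - 1).
  by rewrite SE mulrAC mulfV ?mul1r// subr_eq0.
by field; rewrite ?subr_eq0 ?(eq_sym 1) ?ql ?qM ?q_neq1.
Qed.

(** The limit is [(l+1) / [l+1]_q], in the form that the limit rules produce. *)
Lemma cvg_qriemann_qpow l :
  qriemann (fun x => qpow q x ^+ l) @ \oo -->
  (1 - q) / (1 - q ^+ l.+1) * \sum_(i < l.+1) 1 ^+ i.
Proof.
rewrite (_ : qriemann _ = fun N =>
   (1 - q) / (1 - q ^+ l.+1) * \sum_(i < l.+1) (q ^+ (p ^ N)) ^+ i); last first.
  by apply/funext => N; exact: qriemann_qpow_expr.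
apply: nacvgM (nacvg_cst _ _ _) _; apply: nacvg_sum => i; apply: nacvgX.
exact: (cvg_expr_prime_pow _ _ _ p_prime pabs_p_Cp).
Qed.

Lemma qriemann_qnum_expr n N : qriemann (fun x => qnum q x ^+ n) N =
  ((1 - q) ^+ n)^-1 * \sum_(0 <= l < n.+1)
    'C(n, l)%:R * (-1) ^+ l * qriemann (fun x => qpow q x ^+ l) N.
Proof.
under eq_qriemann do rewrite qnum_expr.
rewrite qriemannZ qriemann_sum; congr (_ * _).
by apply: eq_bigr => l _; rewrite qriemannZ.
Qed.

(** [limn] carries information only once convergence is known; the binomial expansion reduces it to
    powers of [q ^ x]. *)
Lemma cvg_carlitz_bernoulli m :
  qriemann (fun x => qnum q x ^+ m) @ \oo --> carlitz_bernoulli q m.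
Proof.
suff [L cvgL] : exists L : Cp T, qriemann (fun x => qnum q x ^+ m) @ \oo --> L.
  by have -> : carlitz_bernoulli q m = L by exact: nacvg_lim cvgL.
(* The value of the limit is left open and filled in by the limit rules. *)
eexists; rewrite (funext (qriemann_qnum_expr m)).
apply: nacvgM (nacvg_cst _ _ _) _; apply: nacvg_sum => l.
apply: nacvgM (nacvg_cst _ _ _) _; exact: cvg_qriemann_qpow.
Qed.

End QIntegral.

Theorem theorem4 (R : realType) (p : nat) (p_prime : prime p)
    (T : padicTower R p) (q : Cp T) (q_neq1 : q != 1)
    (q_near1 : pabs (q - 1) < p%:R `^ (- (p.-1%:R)^-1))
    (s : nat -> nat -> Cp T) (s_Stirling : is_qStirling1 q s) (n : nat) :
  carlitz_bernoulli q n =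
  ((1 - q) ^+ n)^-1 *
  \sum_(0 <= l < n.+1)
    'C(n, l)%:R * (-1) ^+ l *
    \sum_(0 <= k < l.+1)
      (q - 1) ^+ k * qbinom q l k *
      \sum_(0 <= m < k.+1) s k m * carlitz_bernoulli q m.
Proof.
have cvgB m := cvg_carlitz_bernoulli R p T q p_prime q_neq1 q_near1 m.
(* It remains to show that the same Riemann sums also tend to the right-hand side. *)
apply: nacvg_unique (cvgB n) _.
rewrite (funext (qriemann_qnum_expr R p T q n)).
apply: nacvgM (nacvg_cst _ _ _) _; apply: nacvg_sum => l.
apply: nacvgM (nacvg_cst _ _ _) _.
(* For fixed [N], the Stirling expansion of [(q ^ x) ^ l] passes through the finite sum by
   linearity. *)
rewrite (_ : qriemann R p T q _ = fun N => \sum_(0 <= k < l.+1)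
    (q - 1) ^+ k * qbinom q l k *
    \sum_(0 <= m < k.+1) s k m * qriemann R p T q (fun x => qnum q x ^+ m) N).
  apply: nacvg_sum => k; apply: nacvgM (nacvg_cst _ _ _) _.
  by apply: nacvg_sum => m; exact: nacvgM (nacvg_cst _ _ _) (cvgB m).
apply/funext => N.
under eq_qriemann do rewrite (qpow_expr _ _ _ _ p_prime q_neq1 q_near1 s)//.
rewrite qriemann_sum; apply: eq_bigr => k _.
rewrite qriemannZ; congr (_ * _).
by rewrite qriemann_sum; apply: eq_bigr => m _; rewrite qriemannZ.
Qed.
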